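(* Let $K$ be an algebraically closed field and $L_n$ an $n$-dimensional null-filiform Leibniz algebra over $K$. Let $f(x_1,\dots,x_m)\in\mathcal D(X)$ be a multihomogeneous polynomial of multidegree $(d_1,\dots,d_m)$, with $d_i\ge1$ for all $i$, and let $d=d_1+\cdots+d_m$. Write $f$ modulo $\mathrm{Id}(L_n)$ as $$f(x_1,\dots,x_m)=\sum_{j=1}^m\alpha_j\,x_jx_1^{(d_1)}\cdots x_{j-1}^{(d_{j-1})}x_j^{(d_j-1)}x_{j+1}^{(d_{j+1})}\cdots x_m^{(d_m)},\qquad \alpha_j\in K .$$ 1. If $f$ is a polynomial identity for $L_n$, then the image of $f$ on $L_n$ is $\{0\}$. 2. If $f$ is not a polynomial identity for $L_n$ and $\sum_{i=1}^m\alpha_i=0$, then the image of $f$ on $L_n$ is $(L_n)^{d+1}$. 3. If $f$ is not a polynomial identity for $L_n$ and $\sum_{i=1}^m\alpha_i\ne0$, then: (a) if there exists $j$ such that $d_j=1$ and $\alpha_j\neq0$, then the image of $f$ on $L_n$ is $(L_n)^d$; (b) if $\alpha_j=0$ for all $j$ such that $d_j=1$, then the image of $f$ on $L_n$ is $\{0\}\cup(\dot K\cdot e_d+(L_n)^{d+1})$.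
   Context: A Leibniz algebra over $K$ is a (not necessarily associative) $K$-algebra satisfying $x(yz)=(xy)z-(xz)y$ for all $x,y,z$. For a Leibniz algebra $L$ put $L^1=L$ and $L^{k+1}=L^kL$. An $n$-dimensional Leibniz algebra $L$ is null-filiform if $\dim L^i=n+1-i$ for $1\le i\le n+1$. It is known that every $n$-dimensional null-filiform Leibniz algebra has a basis $e_1,\dots,e_n$ with products $e_ie_1=e_{i+1}$ for $1\le i\le n-1$, all other products of basis elements being zero; such a basis of $L_n$ is fixed. $\mathcal D(X)$ is the free Leibniz $K$-algebra on $X=\{x_1,x_2,\dots\}$; its elements are called polynomials. A polynomial is multihomogeneous of multidegree $(d_1,\dots,d_m)$ if it is a linear combination of monomials having degree $d_i$ in $x_i$ for each $i=1,\dots,m$ (and involving no other variables). A polynomial identity of $L$ is a polynomial vanishing under all evaluations in $L$; $\mathrm{Id}(L)$ is the set of these. Products without brackets are left-normed, and $ab^{(s)}=(\cdots((ab)b)\cdots)b$ with $s$ factors $b$ (omitted if $s=0$). Every multihomogeneous polynomial of multidegree $(d_1,\dots,d_m)$ can be written modulo $\mathrm{Id}(L_n)$ in the form displayed in the claim. The image of $f$ on $L$ is $\{f(a_1,\dots,a_m):a_i\in L\}$. $\dot K=K\setminus\{0\}$, and $\dot K\cdot e_d+(L_n)^{d+1}=\{\lambda e_d+v:\lambda\in\dot K,\ v\in (L_n)^{d+1}\}$. *)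

(* Defs.v *)
From HB Require Import structures.
From mathcomp Require Import all_boot all_order all_algebra.
From mathcomp Require Import boolp classical_sets.

Set Implicit Arguments.
Unset Strict Implicit.
Unset Printing Implicit Defensive.

Import GRing.Theory.
Local Open Scope ring_scope.
Local Open Scope quotient_scope.

HB.mixin Record Lmodule_isLeibniz (K : fieldType) L of GRing.Lmodule K L := {
  lmul : L -> L -> L;
  lmul_linearl : forall y : L, linear (lmul^~ y);
  lmul_linearr : forall x : L, linear (lmul x);
  lmul_leibniz : forall x y z : L,
    lmul x (lmul y z) = lmul (lmul x y) z - lmul (lmul x z) y
}.

#[short(type="leibnizType")]
HB.structure Definition Leibniz (K : fieldType) :=
  {L of GRing.Lmodule K L & Lmodule_isLeibniz K L}.

#[short(type="finLeibnizType")]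
HB.structure Definition FinLeibniz (K : fieldType) :=
  {L of Vector K L & Lmodule_isLeibniz K L}.

Notation "x ** y" := (lmul x y) (at level 40, left associativity) : ring_scope.

Section NullFiliform.
Variables (K : fieldType) (L : finLeibnizType K).

(* The span of all products u ** v with u in U and v in V; by bilinearity it
   suffices to take u and v in bases. *)
Definition lprodv (U V : {vspace L}) : {vspace L} :=
  <<[seq u ** v | u <- vbasis U, v <- vbasis V]>>%VS.

(* L^k, for k >= 1. The value at k = 0 is the junk value L. *)
Definition lpow (k : nat) : {vspace L} :=
  iter k.-1 (fun U => lprodv U fullv) fullv.

Definition null_filiform (n : nat) : Prop :=
  \dim {: L} = n /\
  forall i : nat, (1 <= i <= n + 1)%N -> \dim (lpow i) = (n + 1 - i)%N.

(* Indices are shifted by one: e_i is e`_i.-1. *)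
Definition null_filiform_basis (n : nat) (e : n.-tuple L) : Prop :=
  basis_of fullv e /\
  forall i j : 'I_n,
    e`_i ** e`_j = if (j == 0%N :> nat) && (i.+1 < n)%N then e`_i.+1 else 0.

End NullFiliform.

Arguments lpow {K} L k.
Arguments null_filiform {K} L n.

(* The free Leibniz algebra on countably many generators is the algebra of
   terms in the operations, modulo the congruence generated by the axioms. *)
Section FreeLeibniz.
Variable K : fieldType.

Inductive lterm : Type :=
| LVar of nat
| LZero
| LAdd of lterm & lterm
| LScale of K & lterm
| LMul of lterm & lterm.

Inductive lterm_cong : lterm -> lterm -> Prop :=
| lc_refl t : lterm_cong t t
| lc_sym t u : lterm_cong t u -> lterm_cong u t
| lc_trans t u v : lterm_cong t u -> lterm_cong u v -> lterm_cong t v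
| lc_add t t' u u' :
    lterm_cong t t' -> lterm_cong u u' -> lterm_cong (LAdd t u) (LAdd t' u')
| lc_scale a t t' : lterm_cong t t' -> lterm_cong (LScale a t) (LScale a t')
| lc_mul t t' u u' :
    lterm_cong t t' -> lterm_cong u u' -> lterm_cong (LMul t u) (LMul t' u')
| lc_addA t u v : lterm_cong (LAdd t (LAdd u v)) (LAdd (LAdd t u) v)
| lc_addC t u : lterm_cong (LAdd t u) (LAdd u t)
| lc_add0 t : lterm_cong (LAdd LZero t) t
| lc_addN t : lterm_cong (LAdd (LScale (-1) t) t) LZero
| lc_scaleA a b t : lterm_cong (LScale a (LScale b t)) (LScale (a * b) t)
| lc_scale1 t : lterm_cong (LScale 1 t) t
| lc_scaleDr a t u :
    lterm_cong (LScale a (LAdd t u)) (LAdd (LScale a t) (LScale a u))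
| lc_scaleDl a b t :
    lterm_cong (LScale (a + b) t) (LAdd (LScale a t) (LScale b t))
| lc_mulDl t u v : lterm_cong (LMul (LAdd t u) v) (LAdd (LMul t v) (LMul u v))
| lc_mulDr t u v : lterm_cong (LMul t (LAdd u v)) (LAdd (LMul t u) (LMul t v))
| lc_mulZl a t u : lterm_cong (LMul (LScale a t) u) (LScale a (LMul t u))
| lc_mulZr a t u : lterm_cong (LMul t (LScale a u)) (LScale a (LMul t u))
| lc_leibniz t u v :
    lterm_cong (LMul t (LMul u v))
      (LAdd (LMul (LMul t u) v) (LScale (-1) (LMul (LMul t v) u))).

HB.instance Definition _ := gen_eqMixin lterm.
HB.instance Definition _ := gen_choiceMixin lterm.

Definition lterm_eqv : rel lterm := fun t u => `[< lterm_cong t u >].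

Fact lterm_eqv_refl : reflexive lterm_eqv.
Proof. by move=> t; apply/asboolP; exact: lc_refl. Qed.

Fact lterm_eqv_sym : symmetric lterm_eqv.
Proof. by move=> t u; apply/asboolP/asboolP; exact: lc_sym. Qed.

Fact lterm_eqv_trans : transitive lterm_eqv.
Proof. by move=> u t v /asboolP tu /asboolP uv; apply/asboolP; exact: lc_trans uv. Qed.

Canonical lterm_equiv : equiv_rel lterm :=
  EquivRel lterm_eqv lterm_eqv_refl lterm_eqv_sym lterm_eqv_trans.

Definition freeLeibniz : Type := {eq_quot lterm_equiv}.
HB.instance Definition _ := Choice.on freeLeibniz.

Definition fl_class (t : lterm) : freeLeibniz := \pi_{eq_quot lterm_equiv} t.
Definition fl_repr (p : freeLeibniz) : lterm := repr (p : {eq_quot lterm_equiv}).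

Lemma fl_reprK : cancel fl_repr fl_class.
Proof. exact: reprK. Qed.

Lemma fl_classP (t u : lterm) : fl_class t = fl_class u <-> lterm_cong t u.
Proof.
rewrite /fl_class; split=> [/eqmodP/asboolP //|tu].
by apply/eqmodP/asboolP.
Qed.

Lemma fl_repr_class (t : lterm) : lterm_cong (fl_repr (fl_class t)) t.
Proof. by apply/fl_classP; rewrite fl_reprK. Qed.

Definition fl_zero := fl_class LZero.
Definition fl_add p q := fl_class (LAdd (fl_repr p) (fl_repr q)).
Definition fl_scale a p := fl_class (LScale a (fl_repr p)).
Definition fl_opp p := fl_scale (-1) p.
Definition fl_mul p q := fl_class (LMul (fl_repr p) (fl_repr q)).

Lemma fl_addE t u : fl_add (fl_class t) (fl_class u) = fl_class (LAdd t u).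
Proof. by apply/fl_classP; apply: lc_add; exact: fl_repr_class. Qed.

Lemma fl_scaleE a t : fl_scale a (fl_class t) = fl_class (LScale a t).
Proof. by apply/fl_classP; apply: lc_scale; exact: fl_repr_class. Qed.

Lemma fl_mulE t u : fl_mul (fl_class t) (fl_class u) = fl_class (LMul t u).
Proof. by apply/fl_classP; apply: lc_mul; exact: fl_repr_class. Qed.

Let flE := (fl_addE, fl_scaleE, fl_mulE).

Fact fl_addA : associative fl_add.
Proof.
move=> p q r; rewrite -[p]fl_reprK -[q]fl_reprK -[r]fl_reprK !flE.
by apply/fl_classP; exact: lc_addA.
Qed.

Fact fl_addC : commutative fl_add.
Proof.
move=> p q; rewrite -[p]fl_reprK -[q]fl_reprK !flE.
by apply/fl_classP; exact: lc_addC.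
Qed.

Fact fl_add0 : left_id fl_zero fl_add.
Proof.
by move=> p; rewrite -[p]fl_reprK !flE; apply/fl_classP; exact: lc_add0.
Qed.

Fact fl_addN : left_inverse fl_zero fl_opp fl_add.
Proof.
by move=> p; rewrite /fl_opp -[p]fl_reprK !flE; apply/fl_classP; exact: lc_addN.
Qed.

HB.instance Definition _ :=
  GRing.isZmodule.Build freeLeibniz fl_addA fl_addC fl_add0 fl_addN.

Fact fl_scaleA a b p : fl_scale a (fl_scale b p) = fl_scale (a * b) p.
Proof.
by rewrite -[p]fl_reprK !flE; apply/fl_classP; exact: lc_scaleA.
Qed.

Fact fl_scale1 : left_id 1 fl_scale.
Proof.
by move=> p; rewrite -[p]fl_reprK !flE; apply/fl_classP; exact: lc_scale1.
Qed.

Fact fl_scaleDr : right_distributive fl_scale +%R.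
Proof.
move=> a p q; rewrite -[p]fl_reprK -[q]fl_reprK.
rewrite -[LHS]/(fl_scale _ (fl_add _ _)) -[RHS]/(fl_add _ _) !flE.
by apply/fl_classP; exact: lc_scaleDr.
Qed.

Fact fl_scaleDl p : {morph fl_scale^~ p : a b / a + b}.
Proof.
move=> a b; rewrite -[p]fl_reprK -[RHS]/(fl_add (fl_scale _ _) (fl_scale _ _)).
rewrite !flE.
by apply/fl_classP; exact: lc_scaleDl.
Qed.

HB.instance Definition _ := GRing.Zmodule_isLmodule.Build K freeLeibniz
  fl_scaleA fl_scale1 fl_scaleDr fl_scaleDl.

Fact fl_mul_linearl q : linear (fl_mul^~ q).
Proof.
move=> a p r; rewrite -[p]fl_reprK -[q]fl_reprK -[r]fl_reprK.
rewrite -[LHS]/(fl_mul (fl_add (fl_scale _ _) _) _).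
rewrite -[RHS]/(fl_add (fl_scale _ _) _) !flE; apply/fl_classP.
by apply: lc_trans (lc_mulDl _ _ _) _; apply: lc_add (lc_mulZl _ _ _) (lc_refl _).
Qed.

Fact fl_mul_linearr p : linear (fl_mul p).
Proof.
move=> a q r; rewrite -[p]fl_reprK -[q]fl_reprK -[r]fl_reprK.
rewrite -[LHS]/(fl_mul _ (fl_add (fl_scale _ _) _)).
rewrite -[RHS]/(fl_add (fl_scale _ _) _) !flE; apply/fl_classP.
by apply: lc_trans (lc_mulDr _ _ _) _; apply: lc_add (lc_mulZr _ _ _) (lc_refl _).
Qed.

Fact fl_mul_leibniz p q r :
  fl_mul p (fl_mul q r) = fl_mul (fl_mul p q) r - fl_mul (fl_mul p r) q.
Proof.
rewrite -[p]fl_reprK -[q]fl_reprK -[r]fl_reprK.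
rewrite -[RHS]/(fl_add _ (fl_scale (-1) _)) !flE.
by apply/fl_classP; exact: lc_leibniz.
Qed.

HB.instance Definition _ := Lmodule_isLeibniz.Build K freeLeibniz
  fl_mul_linearl fl_mul_linearr fl_mul_leibniz.

(* The generators x_1, x_2, ... are indexed from 0: x_i is flX i.-1. *)
Definition flX (i : nat) : freeLeibniz := fl_class (LVar i).

End FreeLeibniz.

Arguments flX {K} i.

Section Evaluation.
Variables (K : fieldType) (L : leibnizType K).

Fixpoint lterm_eval (a : nat -> L) (t : lterm K) : L :=
  match t with
  | LVar i => a i
  | LZero => 0
  | LAdd t u => lterm_eval a t + lterm_eval a u
  | LScale c t => c *: lterm_eval a t
  | LMul t u => lterm_eval a t ** lterm_eval a u
  end.

Definition leval (a : nat -> L) (f : freeLeibniz K) : L :=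
  lterm_eval a (fl_repr f).

Definition is_identity (f : freeLeibniz K) : Prop :=
  forall a : nat -> L, leval a f = 0.

(* {f(a_1, ..., a_m) : a_i \in L}, for f involving only x_1, ..., x_m; the
   other variables are sent to the default value 0 of a`_i. *)
Definition image_of (m : nat) (f : freeLeibniz K) : set L :=
  [set leval (fun i => a`_i) f | a in [set: m.-tuple L]].

Lemma lterm_eval_cong (a : nat -> L) t u :
  lterm_cong t u -> lterm_eval a t = lterm_eval a u.
Proof.
have mDl (x y z : L) : (x + y) ** z = x ** z + y ** z.
  by have := lmul_linearl z 1 x y; rewrite !scale1r.
have mDr (x y z : L) : x ** (y + z) = x ** y + x ** z.
  by have := lmul_linearr x 1 y z; rewrite !scale1r.
have m0l (z : L) : 0 ** z = 0.
  by apply: (addrI (0 ** z)); rewrite -mDl !addr0.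
have m0r (z : L) : z ** 0 = 0.
  by apply: (addrI (z ** 0)); rewrite -mDr !addr0.
elim=> {t u} /=.
- by [].
- by move=> t u _ ->.
- by move=> t u v _ -> _ ->.
- by move=> t t' u u' _ -> _ ->.
- by move=> c t t' _ ->.
- by move=> t t' u u' _ -> _ ->.
- by move=> t u v; rewrite addrA.
- by move=> t u; rewrite addrC.
- by move=> t; rewrite add0r.
- by move=> t; rewrite scaleN1r addNr.
- by move=> c b t; rewrite scalerA.
- by move=> t; rewrite scale1r.
- by move=> c t u; rewrite scalerDr.
- by move=> c b t; rewrite scalerDl.
- by move=> t u v; rewrite mDl.
- by move=> t u v; rewrite mDr.
- by move=> c t u; have := lmul_linearl (lterm_eval a u) c (lterm_eval a t) 0;
    rewrite !(addr0, m0l).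
- by move=> c t u; have := lmul_linearr (lterm_eval a t) c (lterm_eval a u) 0;
    rewrite !(addr0, m0r).
- by move=> t u v; rewrite scaleN1r lmul_leibniz.
Qed.

Lemma leval_class (a : nat -> L) t : leval a (fl_class t) = lterm_eval a t.
Proof. exact/lterm_eval_cong/fl_repr_class. Qed.

Lemma leval_var (a : nat -> L) i : leval a (flX i) = a i.
Proof. exact: leval_class. Qed.

Lemma leval_linear (a : nat -> L) : linear (leval a).
Proof.
move=> c f g; rewrite -[f]fl_reprK -[g]fl_reprK.
rewrite -[X in leval a X]/(fl_add (fl_scale _ _) _).
by rewrite fl_scaleE fl_addE !leval_class.
Qed.

Lemma leval_mul (a : nat -> L) f g : leval a (f ** g) = leval a f ** leval a g.
Proof.
rewrite -[f]fl_reprK -[g]fl_reprK -[X in leval a X]/(fl_mul _ _).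
by rewrite fl_mulE !leval_class.
Qed.

(* With the three lemmas above: the universal property of freeLeibniz. *)
Lemma leval_unique (a : nat -> L) (phi : freeLeibniz K -> L) :
    linear phi -> (forall f g, phi (f ** g) = phi f ** phi g) ->
    (forall i, phi (flX i) = a i) ->
  phi =1 leval a.
Proof.
move=> phiL phiM phiX f; rewrite -[f]fl_reprK leval_class.
have phiD g h : phi (g + h) = phi g + phi h.
  by have := phiL 1 g h; rewrite !scale1r.
have phi0 : phi 0 = 0 by apply: (addrI (phi 0)); rewrite -phiD !addr0.
elim: (fl_repr f) => {f} [i||t IHt u IHu|c t IHt|t IHt u IHu] /=.
- exact: phiX.
- exact: phi0.
- by rewrite -fl_addE -IHt -IHu -phiD.
- rewrite -fl_scaleE -IHt.
  by have := phiL c (fl_class t) 0; rewrite phi0 !addr0.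
- by rewrite -fl_mulE -IHt -IHu -phiM.
Qed.

End Evaluation.

Arguments is_identity {K} L f.
Arguments image_of {K} L m f.

Inductive lmonomial : Type :=
| MVar of nat
| MMul of lmonomial & lmonomial.

Fixpoint mdegree (w : lmonomial) (i : nat) : nat :=
  match w with
  | MVar j => (j == i)
  | MMul u v => mdegree u i + mdegree v i
  end.

Section Multihomogeneous.
Variable K : fieldType.

Fixpoint monomial_poly (w : lmonomial) : freeLeibniz K :=
  match w with
  | MVar i => flX i
  | MMul u v => monomial_poly u ** monomial_poly v
  end.

Definition has_multidegree (m : nat) (dg : 'I_m -> nat) (w : lmonomial) : Prop :=
  (forall i : 'I_m, mdegree w i = dg i) /\
  (forall i : nat, (m <= i)%N -> mdegree w i = 0%N).

Definition multihomogeneous (m : nat) (dg : 'I_m -> nat) (f : freeLeibniz K) :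
    Prop :=
  exists (N : nat) (c : 'I_N -> K) (w : 'I_N -> lmonomial),
    (forall k, has_multidegree dg (w k)) /\
    f = \sum_(k < N) c k *: monomial_poly (w k).

(* a b^(s) = (...((a b) b)...) b *)
Definition lmul_rep (L : leibnizType K) (a b : L) (s : nat) : L :=
  iter s (fun y => y ** b) a.

(* x_j x_1^(d_1) ... x_j^(d_j - 1) ... x_m^(d_m), left-normed *)
Definition normal_monomial (m : nat) (dg : 'I_m -> nat) (j : 'I_m) :
    freeLeibniz K :=
  foldl (fun y (i : 'I_m) => lmul_rep y (flX i) (dg i - (i == j))%N)
    (flX j) (enum 'I_m).

Definition normal_form (m : nat) (dg : 'I_m -> nat) (alpha : 'I_m -> K) :
    freeLeibniz K :=
  \sum_(j < m) alpha j *: normal_monomial dg j.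

End Multihomogeneous.

(* Main.v *)
Require Import Defs.
From HB Require Import structures.
From mathcomp Require Import all_boot all_order all_algebra.
From mathcomp Require Import ring.
From mathcomp Require Import boolp classical_sets.

Set Implicit Arguments.
Unset Strict Implicit.
Unset Printing Implicit Defensive.

Import GRing.Theory.
Local Open Scope ring_scope.
Local Open Scope classical_set_scope.

(** In the basis e_1, ..., e_n the product is y b = c (y e_1), where c is the
    e_1-coordinate of b. Let T be the right multiplication by e_1. Then T is a
    nilpotent shift, L^(k+1) is the range of T^k, every b is c e_1 + T u for
    some c and u, and multiplying by b on the right is c T. Hence all the
    factors but the first of a left-normed product only contribute a scalar and
    a power of T. Evaluating the normal form at a_i = c_i e_1 + T u_i gives
      f(a) = (prod_i c_i^(d_i)) (sum_j alpha_j) e_d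
             + T^d (sum_j alpha_j (prod_i c_i^(d_i - [i = j])) u_j)
    ([leval_normal_form]).

    The upper bounds on the image can be read off this formula. In the last case
    it must also be seen that f(a) = 0 as soon as some c_k is 0: a summand j
    other than k contains c_k^(d_k), and the summand k contains c_k^(d_k - 1)
    unless d_k = 1, when alpha_k = 0.

    For the lower bounds it suffices to move a single variable x_j with
    alpha_j nonzero, giving it the value c e_1 + T u and the value e_1 to the
    other variables: f then takes the value
      c^(d_j) (sum_i alpha_i) e_d + alpha_j c^(d_j - 1) T^d u,
    whose second term runs over L^(d+1) when alpha_j c^(d_j - 1) is nonzero
    ([image_of_attains]). If the sum of the alpha_i is 0, take c = 1. If
    d_j = 1, the first coefficient is linear in c, and c = 0 is permitted.
    Otherwise c is a root of an equation c^(d_j) = mu, which is where K has to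
    be algebraically closed. *)

(** * Powers of right multiplications *)

Section RightMultiplication.
Variables (K : fieldType) (L : leibnizType K).

(** A named function of its last argument, so that it can carry a structure of
    linear map. *)
Definition rmul_exp (b : L) (k : nat) (y : L) : L := lmul_rep y b k.

Lemma rmul_expS (b : L) k y : rmul_exp b k.+1 y = rmul_exp b k y ** b.
Proof. by []. Qed.

Lemma rmul_expSr (b : L) k y : rmul_exp b k.+1 y = rmul_exp b k (y ** b).
Proof. exact: iterSr. Qed.

Lemma rmul_exp_is_linear (b : L) k : linear (rmul_exp b k).
Proof.
by move=> c x y; elim: k => // k IHk; rewrite !rmul_expS IHk lmul_linearl.
Qed.

HB.instance Definition _ (b : L) k :=
  GRing.isLinear.Build K L L *:%R (rmul_exp b k) (rmul_exp_is_linear b k).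
HB.instance Definition _ (y : L) :=
  GRing.isLinear.Build K L L *:%R (lmul y) (lmul_linearr y).
HB.instance Definition _ (a : nat -> L) :=
  GRing.isLinear.Build K (freeLeibniz K) L *:%R (leval a) (leval_linear a).

Lemma rmul_expD (b : L) k x y :
  rmul_exp b k (x + y) = rmul_exp b k x + rmul_exp b k y.
Proof. exact: linearD. Qed.

Lemma rmul_expZ (b : L) k (c : K) y :
  rmul_exp b k (c *: y) = c *: rmul_exp b k y.
Proof. exact: linearZ_LR. Qed.

Lemma lmul0l (b : L) : 0 ** b = 0.
Proof. exact: (linear0 (rmul_exp b 1)). Qed.

Lemma lmulZl (b : L) (c : K) (y : L) : (c *: y) ** b = c *: (y ** b).
Proof. exact: (linearZ_LR (rmul_exp b 1)). Qed.

Lemma lmul_suml (b : L) (I : Type) (r : seq I) (P : pred I) (F : I -> L) :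
  (\sum_(i <- r | P i) F i) ** b = \sum_(i <- r | P i) F i ** b.
Proof. exact: (linear_sum (rmul_exp b 1)). Qed.

Lemma rmul_exp_scaled (t b : L) (c : K) :
    (forall y, y ** b = c *: (y ** t)) ->
  forall k y, rmul_exp b k y = c ^+ k *: rmul_exp t k y.
Proof.
move=> cbt; elim=> [|k IHk] y; first by rewrite scale1r.
by rewrite !rmul_expSr IHk cbt rmul_expZ scalerA exprSr.
Qed.

(** The factors after the first can be collected because each of them acts as
    a multiple of the same operator. *)
Lemma foldl_rmul_exp (I : Type) (t : L) (b : I -> L) (c : I -> K)
    (s : I -> nat) (r : seq I) (y : L) :
    (forall i z, z ** b i = c i *: (z ** t)) ->
  foldl (fun y i => rmul_exp (b i) (s i) y) y r =
    (\prod_(i <- r) c i ^+ s i) *: rmul_exp t (\sum_(i <- r) s i) y.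
Proof.
move=> cbt; elim: r y => [|i r IHr] y /=; first by rewrite !big_nil scale1r.
rewrite IHr !big_cons (rmul_exp_scaled (cbt i)) rmul_expZ scalerA mulrC.
by rewrite addnC [in RHS]/rmul_exp /lmul_rep iterD.
Qed.

Lemma leval_foldl_lmul_rep (I : Type) (a : nat -> L) (x : I -> nat)
    (s : I -> nat) (r : seq I) (p : freeLeibniz K) :
  leval a (foldl (fun y i => lmul_rep y (flX (x i)) (s i)) p r) =
    foldl (fun y i => rmul_exp (a (x i)) (s i) y) (leval a p) r.
Proof.
elim: r p => //= i r IHr p; rewrite IHr; congr foldl.
elim: (s i) => // k IHk.
by rewrite rmul_expS -IHk /lmul_rep /= leval_mul leval_var.
Qed.

End RightMultiplication.

(** * The null-filiform algebra *)

Lemma memv_lprodv (K : fieldType) (L : finLeibnizType K) (U V : {vspace L})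
    (u v : L) :
  u \in U -> v \in V -> u ** v \in lprodv U V.
Proof.
move=> /coord_vbasis-> /coord_vbasis->; rewrite linear_sum.
apply: memv_suml => j _; rewrite linearZ memvZ //= lmul_suml.
apply: memv_suml => i _; rewrite lmulZl memvZ // memv_span //.
by apply/allpairsP; exists ((vbasis U)`_i, (vbasis V)`_j);
  split=> //=; rewrite mem_nth ?size_tuple.
Qed.

Section NullFiliform.
Variables (K : fieldType) (L : finLeibnizType K) (n : nat) (e : n.-tuple L).
Hypothesis e_basis : null_filiform_basis e.

Local Notation T := (rmul_exp e`_0).

Lemma basis_expansion (b : L) : b = \sum_(i < n) coord e i b *: e`_i.
Proof. exact: coord_basis e_basis.1 (memvf b). Qed.

(** This includes the indices out of range, where the default value of e`_k is
    0. *)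
Lemma mul_basis_first k : e`_k ** e`_0 = e`_k.+1.
Proof.
have [kn|nk] := ltnP k n.
  have := e_basis.2 (Ordinal kn) (Ordinal (leq_ltn_trans (leq0n k) kn)).
  rewrite eqxx /= => ->; case: (ltnP k.+1 n) => // nk.
  by rewrite nth_default ?size_tuple.
rewrite [e`_k]nth_default ?[e`_k.+1]nth_default ?size_tuple ?leqW //.
exact: lmul0l.
Qed.

Lemma rmul_exp_first k : T k e`_0 = e`_k.
Proof. by elim: k => // k IHk; rewrite rmul_expS IHk mul_basis_first. Qed.

Lemma mul_basis_gt0 (y : L) j : y ** e`_j.+1 = 0.
Proof.
have [jn|nj] := ltnP j.+1 n; last first.
  by rewrite nth_default ?size_tuple // linear0.
rewrite (basis_expansion y) lmul_suml big1 // => i _.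
by rewrite lmulZl (e_basis.2 i (Ordinal jn)) scaler0.
Qed.

(** By the multiplication table, only e_1 acts nontrivially from the right, and
    the range of the right multiplication by e_1 involves e_2, e_3, ... only. *)
Lemma mul_square_r (y u : L) : y ** (u ** e`_0) = 0.
Proof.
rewrite (basis_expansion u) lmul_suml linear_sum big1 // => i _.
by rewrite lmulZl linearZ /= mul_basis_first mul_basis_gt0 scaler0.
Qed.

Lemma mul_leading (c : K) (u y : L) :
  y ** (c *: e`_0 + u ** e`_0) = c *: (y ** e`_0).
Proof. by rewrite linearD linearZ /= mul_square_r addr0. Qed.

Lemma leading_decomposition (b : L) :
  exists cu : K * L, b = cu.1 *: e`_0 + cu.2 ** e`_0.
Proof.
exists (\sum_(i < n | i == 0%N :> nat) coord e i b,
        \sum_(i < n | i != 0%N :> nat) coord e i b *: e`_i.-1) => /=.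
rewrite [LHS]basis_expansion (bigID (fun i : 'I_n => i == 0%N :> nat)) /=.
rewrite scaler_suml lmul_suml; congr (_ + _); apply: eq_bigr => i.
  by move=> /eqP->.
rewrite -lt0n => i_gt0.
by rewrite lmulZl mul_basis_first prednK.
Qed.

(** Right multiplication by any b is a multiple of T, so the product of a
    subspace with L is the image of the subspace under T. *)
Lemma memv_lpowP k (v : L) : v \in lpow L k.+1 <-> exists u, v = T k u.
Proof.
elim: k v => [|k IHk] v; first by split=> [_|_]; [exists v | exact: memvf].
rewrite -[lpow L k.+2]/(lprodv (lpow L k.+1) fullv); split=> [|[u ->]].
  have sub_img :
      (lprodv (lpow L k.+1) fullv <= linfun (T 1) @: lpow L k.+1)%VS.
    apply/span_subvP => _ /allpairsP[[x b] /= [/vbasis_mem x_in _ ->]].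
    have [[c u] /= ->] := leading_decomposition b; rewrite mul_leading.
    rewrite memvZ //; apply/memv_imgP; exists x => //.
    by rewrite lfunE.
  move=> /(subvP sub_img) /memv_imgP[x /IHk[u ->] ->].
  by exists u; rewrite lfunE.
rewrite rmul_expS; apply: memv_lprodv (memvf _).
by apply/IHk; exists u.
Qed.

(** * Values of the normal form *)

Section Evaluation.
Variables (m : nat) (dg : 'I_m -> nat) (alpha : 'I_m -> K).
Hypothesis dg_gt0 : forall i, (1 <= dg i)%N.

Local Notation d := (\sum_(i < m) dg i)%N.

Lemma sum_degrees_gt0 (j : 'I_m) : (0 < d)%N.
Proof. by rewrite (bigD1 j) //= addn_gt0 dg_gt0. Qed.

Lemma sum_degrees_but_first (j : 'I_m) :
  (\sum_(i < m) (dg i - (i == j)) = d.-1)%N.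
Proof.
rewrite (bigD1 j) //= [in RHS](bigD1 j) //= eqxx subn1.
rewrite (eq_bigr dg) => [|i /negPf->]; last by rewrite subn0.
by rewrite -[in RHS](prednK (dg_gt0 j)).
Qed.

Lemma prod_exp_but_first (c : 'I_m -> K) (j : 'I_m) :
  c j * \prod_(i < m) c i ^+ (dg i - (i == j)) = \prod_(i < m) c i ^+ dg i.
Proof.
rewrite (bigD1 j) //= [in RHS](bigD1 j) //= eqxx subn1 mulrA -exprS.
rewrite prednK //; congr (_ * _).
by apply: eq_bigr => i /negPf->; rewrite subn0.
Qed.

(** The e_1-component of a_j restores the factor c_j missing from the product
    of the other factors, and T^(d - 1) sends e_1 to e_d; this is why all the
    summands have proportional e_d-components. *)
Lemma leval_normal_form (a : nat -> L) (c : 'I_m -> K) (u : 'I_m -> L) :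
    (forall i : 'I_m, a i = c i *: e`_0 + u i ** e`_0) ->
  leval a (normal_form dg alpha) =
    ((\prod_(i < m) c i ^+ dg i) * \sum_(j < m) alpha j) *: e`_d.-1 +
    T d (\sum_(j < m)
           (alpha j * \prod_(i < m) c i ^+ (dg i - (i == j))) *: u j).
Proof.
move=> aE; have ca i z : z ** a (i : 'I_m) = c i *: (z ** e`_0).
  by rewrite aE mul_leading.
rewrite /normal_form !linear_sum mulr_sumr scaler_suml -big_split.
apply: eq_bigr => j _; rewrite !linearZ /=.
rewrite [leval a _](leval_foldl_lmul_rep a (@nat_of_ord m)) leval_var.
rewrite (foldl_rmul_exp _ _ _ ca) !big_enum /=.
rewrite sum_degrees_but_first aE rmul_expD rmul_expZ rmul_exp_first.
rewrite -(prod_exp_but_first c j) -rmul_expSr (prednK (sum_degrees_gt0 j)).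
rewrite !scalerDr !scalerA; congr (_ *: _ + _); ring.
Qed.

Section Image.
Variable f : freeLeibniz K.
Hypothesis f_normal : is_identity L (f - normal_form dg alpha).

Lemma leval_normal (a : nat -> L) : leval a f = leval a (normal_form dg alpha).
Proof.
by apply/eqP; rewrite -subr_eq0 -(linearB (leval a)); apply/eqP/f_normal.
Qed.

Lemma image_ofP (v : L) :
  image_of L m f v -> exists (c : 'I_m -> K) (u : 'I_m -> L),
    v = ((\prod_(i < m) c i ^+ dg i) * \sum_(j < m) alpha j) *: e`_d.-1 +
      T d (\sum_(j < m)
             (alpha j * \prod_(i < m) c i ^+ (dg i - (i == j))) *: u j).
Proof.
move=> [a _ <-]; have [cu cuE] := choice leading_decomposition.
exists (fun i => (cu a`_i).1), (fun i => (cu a`_i).2).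
by rewrite leval_normal; apply: leval_normal_form => i.
Qed.

Lemma image_of0 (j : 'I_m) : image_of L m f 0.
Proof.
exists (nseq_tuple m 0) => //.
rewrite leval_normal (leval_normal_form (c := fun=> 0) (u := fun=> 0)).
  rewrite [X in X * _](bigD1 j) //= expr0n eqn0Ngt dg_gt0 !mul0r scale0r add0r.
  rewrite [X in T d X]big1 => [|i _]; last exact: scaler0.
  exact: (linear0 (T d)).
by move=> i; rewrite scale0r lmul0l addr0 nth_nseq ltn_ord.
Qed.

(** With c = 0 allowed when d_j = 1, since then c^(d_j - 1) = 1. *)
Lemma image_of_attains (j : 'I_m) (c : K) (w : L) :
    alpha j * c ^+ (dg j).-1 != 0 ->
  image_of L m f ((c ^+ dg j * \sum_(i < m) alpha i) *: e`_d.-1 + T d w).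
Proof.
move=> ajc_neq0.
pose cs (i : 'I_m) := if i == j then c else 1.
(* The scalar cancels the coefficient of u j in the value of f. *)
pose u (i : 'I_m) := if i == j then (alpha j * c ^+ (dg j).-1)^-1 *: w else 0.
exists [tuple cs i *: e`_0 + u i ** e`_0 | i < m] => //.
rewrite leval_normal (leval_normal_form (c := cs) (u := u)) => [|i]; last first.
  by rewrite -tnth_nth tnth_mktuple.
have csE (s : 'I_m -> nat) : \prod_(i < m) cs i ^+ s i = c ^+ s j.
  rewrite (bigD1 j) //= /cs eqxx big1 ?mulr1 // => i /negPf->.
  by rewrite expr1n.
rewrite csE [X in T d X](bigD1 j) //=.
rewrite [X in T d (_ + X)]big1 => [|i /negPf ij]; last first.
  by rewrite /u ij scaler0.
by rewrite csE /u !eqxx subn1 addr0 scalerA mulfV // scale1r.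
Qed.

(** If c_k = 0, all the summands of f(a) but the one starting with x_k contain
    the factor c_k^(d_k), and that one contains c_k^(d_k - 1). *)
Lemma image_of_leading_or_zero (v : L) :
    (forall j, dg j = 1%N -> alpha j = 0) -> image_of L m f v ->
  v = 0 \/ exists (l : K) (w : L),
    l != 0 /\ v = (l * \sum_(j < m) alpha j) *: e`_d.-1 + T d w.
Proof.
move=> alpha0 /image_ofP[c [u ->]].
have [prod0|prod_neq0] := eqVneq (\prod_(i < m) c i ^+ dg i) 0; last first.
  by right; do 2!eexists; split; first exact: prod_neq0.
left; rewrite prod0 mul0r scale0r add0r [X in T d X]big1 => [|j _].
  exact: (linear0 (T d)).
move/eqP/prodf_eq0: prod0 => [k _]; rewrite expf_eq0 => /andP[_ /eqP ck0].
rewrite (bigD1 k) //= ck0 expr0n subn_eq0.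
(* The factor c_k^(d_k - [k = j]) is 0^0 only if j = k and d_k = 1. *)
have [->|_] := eqVneq k j; last first.
  by rewrite leqNgt dg_gt0 !(mul0r, mulr0) scale0r.
have [dj_le1|dj_gt1] := leqP (dg j) 1; last by rewrite !(mul0r, mulr0) scale0r.
by rewrite alpha0 ?mul0r ?scale0r //; apply/eqP; rewrite eqn_leq dj_le1 dg_gt0.
Qed.

End Image.
End Evaluation.
End NullFiliform.

(** * The image *)

Lemma closed_field_root (K : closedFieldType) (k : nat) (l : K) :
  (0 < k)%N -> exists c, c ^+ k = l.
Proof.
move=> k_gt0.
have [c cE] :=
  GRing.solve_monicpoly k (fun i => if i == 0%N then l else 0) k_gt0.
exists c; rewrite cE (bigD1 (Ordinal k_gt0)) //= mulr1 big1 ?addr0 // => i.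
by rewrite -val_eqE /= => /negPf->; rewrite mul0r.
Qed.

Theorem theorem16 (K : closedFieldType) (n : nat) (L : finLeibnizType K)
    (L_nf : null_filiform L n)
    (e : n.-tuple L) (e_basis : null_filiform_basis e)
    (m : nat) (dg : 'I_m -> nat) (dg_gt0 : forall i, (1 <= dg i)%N)
    (f : freeLeibniz K) (f_hom : multihomogeneous dg f)
    (alpha : 'I_m -> K)
    (f_normal : is_identity L (f - normal_form dg alpha)) :
  let d := (\sum_(i < m) dg i)%N in
  [/\ is_identity L f -> image_of L m f = [set 0],
      ~ is_identity L f -> \sum_(i < m) alpha i = 0 ->
        image_of L m f = [set v : L | v \in lpow L d.+1] &
      ~ is_identity L f -> \sum_(i < m) alpha i != 0 ->
        ((exists j : 'I_m, dg j = 1%N /\ alpha j != 0) ->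
           image_of L m f = [set v : L | v \in lpow L d]) /\
        ((forall j : 'I_m, dg j = 1%N -> alpha j = 0) ->
           image_of L m f =
             [set 0] `|` [set w : L | exists (lambda : K) (v : L),
                [/\ lambda != 0, v \in lpow L d.+1 &
                    w = lambda *: e`_d.-1 + v]])].
Proof.
move=> d; have attains := image_of_attains e_basis dg_gt0 f_normal.
have imageP := image_ofP e_basis dg_gt0 f_normal.
rewrite -/d in attains imageP.
split=> [f_id|f_nid sum0|f_nid sum_neq0].
- rewrite eqEsubset; split=> [_ [a _ <-]|_ ->]; first exact: f_id.
  by exists (nseq_tuple m 0); rewrite ?f_id.
- have [j aj_neq0] : exists j, alpha j != 0.
    apply: contrapT => no_j; apply: f_nid => a.
    rewrite (leval_normal f_normal) /normal_form big1 ?linear0 // => j _.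
    have [->|aj] := eqVneq (alpha j) 0; first by rewrite scale0r.
    by case: no_j; exists j.
  rewrite eqEsubset; split=> v /=.
    move=> /imageP[c [u ->]]; rewrite sum0 mulr0 scale0r add0r.
    by apply/(memv_lpowP e_basis); eexists.
  move=> /(memv_lpowP e_basis)[w ->]; have := attains j 1 w.
  by rewrite !expr1n mulr1 sum0 mulr0 scale0r add0r; apply.
- have [j aj_neq0] : exists j, alpha j != 0.
    apply: contrapT => no_j; move/eqP: sum_neq0; apply; apply: big1 => j _.
    by apply: contrapT => /eqP aj; apply: no_j; exists j.
  have d_gt0 : (0 < d)%N := sum_degrees_gt0 dg_gt0 j.
  split=> [[k [dk1 ak_neq0]]|alpha0]; rewrite eqEsubset; split=> v /=.
  + move=> /imageP[c [u ->]]; rewrite -(prednK d_gt0).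
    apply/(memv_lpowP e_basis); rewrite -(rmul_exp_first e_basis).
    by rewrite -rmul_expZ rmul_expSr -rmul_expD; eexists.
  + rewrite -(prednK d_gt0) => /(memv_lpowP e_basis)[z ->].
    have [[c u] /= ->] := leading_decomposition e_basis z.
    (* As d_k = 1, this value of x_k gives e_d the coefficient c. *)
    have := attains k (c / \sum_(i < m) alpha i) u.
    rewrite dk1 mulr1 divfK // => /(_ ak_neq0).
    rewrite rmul_expD rmul_expZ (rmul_exp_first e_basis) -rmul_expSr.
    by rewrite (prednK d_gt0).
  + move=> /(image_of_leading_or_zero e_basis dg_gt0 f_normal alpha0).
    move=> [->|[l [w [l_neq0 ->]]]]; [by left|right].
    do 2!eexists; split; last by []; first by rewrite mulf_neq0.
    by apply/(memv_lpowP e_basis); exists w.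
  + move=> [->|[l [_ [l_neq0 /(memv_lpowP e_basis)[w ->] ->]]]].
      exact: (image_of0 e_basis dg_gt0 f_normal j).
    have [c cE] := closed_field_root (l / \sum_(i < m) alpha i) (dg_gt0 j).
    have := attains j c w; rewrite cE divfK //; apply.
    rewrite mulf_neq0 // expf_neq0 //; apply: contra l_neq0 => /eqP c0.
    move: cE; rewrite c0 expr0n eqn0Ngt dg_gt0 /= => /esym/eqP.
    by rewrite mulf_eq0 invr_eq0 (negPf sum_neq0) orbF.
Qed.
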